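(* Let $\mathcal{P}$ be the convex cone of symmetric quartic forms $f\in\mathbb{R}[a_0,a_1,a_2,a_3]$ with $f(1,1,1,1)=0$ and $f\ge0$ on $\mathbb{R}^4$. With $\sigma_k$ the $k$-th elementary symmetric polynomial of $a_0,\dots,a_3$, define for $t\in\mathbb{R}$ $$\mathfrak{g}_t=\tfrac13\Big(3\sigma_1^4-2(t+7)\sigma_1^2\sigma_2+(t+3)^2\sigma_2^2-2(t^2-9)\sigma_1\sigma_3-4(t+3)^2\sigma_4\Big),$$ $$\mathfrak{g}_\infty=\sigma_2^2-2\sigma_1\sigma_3-4\sigma_4,\qquad \mathfrak{p}=\sigma_2^2-3\sigma_1\sigma_3+12\sigma_4 .$$ Then the extremal elements of $\mathcal{P}$ are exactly the positive multiples of $\mathfrak{g}_t$ ($t\in\mathbb{R}$), $\mathfrak{g}_\infty$ and $\mathfrak{p}$. Moreover: (a) for $t\in\mathbb{R}$, $t\ne 1,-3$, $\mathfrak{g}_t$ is characterized by the equality conditions $\mathfrak{g}_t(t,1,1,1)=\mathfrak{g}_t(-1,-1,1,1)=0$; (b) $\mathfrak{g}_1$ is characterized by the equality conditions $\mathfrak{g}_1(x,x,1,1)=0$ for all $x\in\mathbb{P}^1_{\mathbb{R}}$ (equivalently $\mathfrak{g}_1(x,x,y,y)=0$ for all $(x:y)\in\mathbb{P}^1_{\mathbb{R}}$); (c) $\mathfrak{g}_{-3}$ is characterized by the equality conditions $\mathfrak{g}_{-3}(a,b,c,-a-b-c)=0$ for all $a,b,c\in\mathbb{R}$; (d) $\mathfrak{g}_\infty$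 is characterized by the equality conditions $\mathfrak{g}_\infty(0,0,0,1)=\mathfrak{g}_\infty(-1,-1,1,1)=0$; (e) $\mathfrak{p}$ is characterized by the equality conditions $\mathfrak{p}(0,0,0,1)=0$ and $\mathfrak{p}(s,1,1,1)=0$ for all $s\in\mathbb{R}$.
   Context: An element $0\neq f\in\mathcal{P}$ is extremal if whenever $f=g+h$ with $g,h\in\mathcal{P}$, both $g$ and $h$ are scalar multiples of $f$. One says that $f\in\mathcal{P}$ is characterized by the equality conditions $f(\mathbf{x}_\lambda)=0$ ($\lambda\in\Lambda$) if $\{g\in\mathcal{P}: g(\mathbf{x}_\lambda)=0 \text{ for all }\lambda\in\Lambda\}=\mathbb{R}_+\cdot f$, where $\mathbb{R}_+=\{x\in\mathbb{R}: x\ge0\}$. *)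

(* Defs.v *)
From mathcomp Require Import all_boot all_order all_algebra.
From mathcomp Require Import reals.
From mathcomp Require Import mpoly.

Set Implicit Arguments.
Unset Strict Implicit.
Unset Printing Implicit Defensive.

Import Order.TTheory GRing.Theory Num.Theory.
Local Open Scope ring_scope.

(* The variable a_i is 'X_i, for i : 'I_4. *)
Definition sigma (R : realType) (k : nat) : {mpoly R[4]} := mesym 4 R k.

Definition pt4 (R : realType) (a b c d : R) : 'I_4 -> R :=
  tnth [tuple a; b; c; d].

(* The zero polynomial is symmetric and 4.-homog, so the cone contains 0. *)
Definition coneP (R : realType) (f : {mpoly R[4]}) : Prop :=
  [/\ f \is symmetric,
      f \is 4.-homog,
      f.@[pt4 1 1 1 1] = 0
    & forall v : 'I_4 -> R, 0 <= f.@[v]].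

Definition extremal (R : realType) (f : {mpoly R[4]}) : Prop :=
  [/\ coneP f,
      f != 0
    & forall g h : {mpoly R[4]}, coneP g -> coneP h -> f = g + h ->
        (exists c : R, g = c *: f) /\ (exists d : R, h = d *: f)].

(* The family (x_lambda) is given as the set X of its values. *)
Definition characterized_by (R : realType) (f : {mpoly R[4]})
    (X : ('I_4 -> R) -> Prop) : Prop :=
  coneP f /\
  forall g : {mpoly R[4]},
    (coneP g /\ forall v, X v -> g.@[v] = 0) <->
    (exists c : R, 0 <= c /\ g = c *: f).

Definition g_ (R : realType) (t : R) : {mpoly R[4]} :=
  3^-1 *:
    (3 *: sigma R 1 ^+ 4
     - (2 * (t + 7)) *: (sigma R 1 ^+ 2 * sigma R 2)
     + (t + 3) ^+ 2 *: sigma R 2 ^+ 2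
     - (2 * (t ^+ 2 - 9)) *: (sigma R 1 * sigma R 3)
     - (4 * (t + 3) ^+ 2) *: sigma R 4).

Definition g_infty (R : realType) : {mpoly R[4]} :=
  sigma R 2 ^+ 2 - 2 *: (sigma R 1 * sigma R 3) - 4 *: sigma R 4.

Definition p_ (R : realType) : {mpoly R[4]} :=
  sigma R 2 ^+ 2 - 3 *: (sigma R 1 * sigma R 3) + 12 *: sigma R 4.

(* Main.v *)
Require Import Defs.
From mathcomp Require Import all_boot all_order all_algebra.
From mathcomp Require Import reals.
From mathcomp Require Import mpoly.
From mathcomp Require Import ring lra zify.

Import Order.TTheory GRing.Theory Num.Theory.
Local Open Scope ring_scope.

(** A symmetric quartic [f] vanishing at (1,1,1,1) is singular there: by symmetry
its gradient is a multiple of (1,1,1,1), and the multiple is 0 by Euler.  Hence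
  f(x,y,y,y) = (x-y)^2 (q2 x^2 + q1 x y + q0 y^2),
and comparing Hessians at (1,1,1,1),
  f(x,x,y,y) = (x-y)^2 ((q0+q1+q2)/3 (x+y)^2 + mu (x-y)^2).
The space of such [f] has dimension 4 and (q0, q1, q2, mu) are coordinates on it;
[cone_form q0 q1 q2 mu] is the form with given coordinates.

In these coordinates the cone is a product ([conePE]): [f] is nonnegative iff the
binary quadratic form [q] is positive semidefinite and [mu >= 0].  Necessity
is read off the two restrictions above; sufficiency is the sum of squares
hidden in [cone_form_eval].  For g_t the quadratic form is (x - t y)^2, for
g_infty it is 3 y^2, both with [mu = 0]; p has [q = 0] and [mu = 1].

The theorem is then about the product of the cone of semidefinite binary
quadratic forms with a half-line.  Its extremal rays are the squares of linear
forms, with [mu = 0], and the half-line itself.  As for the equality conditions,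
vanishing at (-1,-1,1,1) means [mu = 0], vanishing at (t,1,1,1) with t <> 1 means
that [q] vanishes at (t : 1), and a semidefinite [q] with a zero at (t : 1) is
a multiple of (x - t y)^2 ([psd_root]).  Finally, a form characterized by
its zeros is extremal, because the summands of a decomposition inherit
the zeros ([extremal_of_characterized]). *)

(** * Symmetric quartic forms in four variables *)

(** The subsets of size k+1 either avoid the last variable or contain it, which
allows elementary symmetric polynomials to be evaluated by recursion. *)
Lemma meval_mesymSS (R : comNzRingType) (n k : nat) (v : 'I_n.+1 -> R) :
  (mesym n.+1 R k.+1).@[v] =
    (mesym n R k.+1).@[v \o widen_ord (leqnSn n)]
    + (mesym n R k).@[v \o widen_ord (leqnSn n)] * v ord_max.
Proof.
have mevalW p : (mwiden p).@[v] = p.@[v \o widen_ord (leqnSn n)].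
  elim/mpolyind: p => [|k' m p _ _ IHp]; first by rewrite !raddf0.
  rewrite !raddfD /= IHp mwidenZ !mevalZ; congr (_ * _ + _).
  rewrite mwidenX !mevalX big_ord_recr /= mnmwiden_ordmax.
  rewrite expr0 mulr1; apply: eq_bigr => i _.
  by rewrite mnmwiden_widen.
by rewrite mesymSS mevalD mevalM mevalXU !mevalW.
Qed.

Lemma sigma_eval (R : realType) (a b c d : R) :
  [/\ (sigma R 1).@[pt4 a b c d] = a + b + c + d,
      (sigma R 2).@[pt4 a b c d] = a * b + a * c + a * d + b * c + b * d + c * d,
      (sigma R 3).@[pt4 a b c d] = a * b * c + a * b * d + a * c * d + b * c * d
    & (sigma R 4).@[pt4 a b c d] = a * b * c * d].
Proof.
have e0 n (v : 'I_n -> R) : (mesym n R 0).@[v] = 1 by rewrite mesym0E meval1.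
have e1 k (v : 'I_0 -> R) : (mesym 0 R k.+1).@[v] = 0.
  by rewrite mesym_geqnE // meval0.
rewrite /sigma !meval_mesymSS !e0 !e1 /= /pt4 !(tnth_nth 0) /=.
split; ring.
Qed.

Lemma pt4_eta (R : realType) (v : 'I_4 -> R) :
  v =1 pt4 (v 0) (v 1) (v 2%:R) (v 3%:R).
Proof.
move=> i; rewrite /pt4 (tnth_nth 0).
by case: i => -[|[|[|[|i]]]] //= lt_i; congr v; apply/val_inj.
Qed.

Definition quartic {R : realType} (a b c d e : R) : {mpoly R[4]} :=
  a *: sigma R 1 ^+ 4 + b *: (sigma R 1 ^+ 2 * sigma R 2)
  + c *: sigma R 2 ^+ 2 + d *: (sigma R 1 * sigma R 3) + e *: sigma R 4.

Lemma quarticD (R : realType) (a b c d e a' b' c' d' e' : R) :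
  quartic a b c d e + quartic a' b' c' d' e' =
  quartic (a + a') (b + b') (c + c') (d + d') (e + e').
Proof.
rewrite /quartic !scalerDl. ring.
Qed.

Lemma quarticZ (R : realType) (k a b c d e : R) :
  k *: quartic a b c d e = quartic (k * a) (k * b) (k * c) (k * d) (k * e).
Proof. by rewrite /quartic !scalerDr !scalerA. Qed.

Lemma quartic_sym (R : realType) (a b c d e : R) :
  quartic a b c d e \is symmetric.
Proof.
by rewrite /quartic !(rpredD, rpredZ, rpredM, rpredX) // mesym_sym.
Qed.

Lemma quartic_homog (R : realType) (a b c d e : R) :
  quartic a b c d e \is 4.-homog.
Proof.
have h k := dhomog_mesym 4 R k.
rewrite /quartic !rpredD // dhomogZ //.
- exact: (dhomogMn 4 (h 1%N)).
- exact: (dhomogM (dhomogMn 2 (h 1%N)) (h 2)).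
- exact: (dhomogMn 2 (h 2)).
- exact: (dhomogM (h 1%N) (h 3)).
exact: (h 4).
Qed.

(** By the fundamental theorem, [f] is a polynomial in the sigma_k, isobaric of
weight 4; the partitions of 4 leave five monomials. *)
Lemma sym_quarticP (R : realType) (f : {mpoly R[4]}) :
  f \is symmetric -> f \is 4.-homog ->
  exists a b c d e, f = quartic a b c d e.
Proof.
move=> fsym fhom; have [t [<- thom]] := sym_fundamental_homog fsym fhom.
rewrite comp_mpolyEX.
pose P (p : {mpoly R[4]}) := exists a b c d e, p = quartic a b c d e.
rewrite -/(P _) big_seq; apply: (big_ind P).
- by exists 0, 0, 0, 0, 0; rewrite /quartic !scale0r !addr0.
- move=> x y [a [b [c [d [e ->]]]]] [a' [b' [c' [d' [e' ->]]]]].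
  by rewrite quarticD; do 5! eexists.
move=> m m_t; have /= := dhomogP _ _ _ thom m m_t.
rewrite comp_mpolyX /mnmwgt !big_ord_recr !big_ord0 /= !tnth_mktuple.
rewrite add0n muln1 mul1r.
set i0 := widen_ord _ _; set i1 := widen_ord _ _; set i2 := widen_ord _ _.
rewrite -/(sigma R 1) -/(sigma R 2) -/(sigma R 3) -/(sigma R 4).
(* From here on k1, ..., k4 are the exponents of sigma_1, ..., sigma_4. *)
move: (m i0) (m i1) (m i2) (m ord_max) => k1 k2 k3 k4 wt.
have scaled a b c d e (p : {mpoly R[4]}) :
    p = quartic a b c d e -> P (t@_m *: p).
  by move=> ->; rewrite quarticZ; do 5! eexists.
case: k4 wt => [|[|k4]]; case: k3 => [|[|k3]]; case: k2 => [|[|[|k2]]];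
  case: k1 => [|[|[|[|[|k1]]]]] wt; try (exfalso; lia);
  rewrite !(expr0, expr1, mulr1, mul1r).
- by apply: (scaled 1 0 0 0 0); rewrite /quartic !scale0r scale1r !addr0.
- by apply: (scaled 0 1 0 0 0); rewrite /quartic !scale0r scale1r !addr0 add0r.
- by apply: (scaled 0 0 1 0 0); rewrite /quartic !scale0r scale1r !addr0 add0r.
- by apply: (scaled 0 0 0 1 0); rewrite /quartic !scale0r scale1r !addr0 add0r.
by apply: (scaled 0 0 0 0 1); rewrite /quartic !scale0r scale1r !addr0 add0r.
Qed.

(** * Positive semidefinite binary quadratic forms *)

Definition qform {R : realFieldType} (q0 q1 q2 x y : R) : R :=
  q2 * x ^+ 2 + q1 * (x * y) + q0 * y ^+ 2.

Definition psd {R : realFieldType} (q0 q1 q2 : R) : Prop :=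
  [/\ 0 <= q0, 0 <= q2 & q1 ^+ 2 <= 4 * q0 * q2].

Lemma psd_sqr (R : realFieldType) (t : R) : psd (t ^+ 2) (- 2 * t) 1.
Proof.
by split; rewrite ?sqr_ge0 ?ler01 // exprMn sqrrN mulr1 -natrX.
Qed.

Lemma psd_const (R : realFieldType) (c : R) : 0 <= c -> psd c 0 0.
Proof. by move=> c_ge0; split=> //; rewrite mulr0 expr0n. Qed.

Lemma psd_ge0 (R : realFieldType) (q0 q1 q2 x y : R) :
  psd q0 q1 q2 -> 0 <= qform q0 q1 q2 x y.
Proof.
move=> [q0_ge0 q2_ge0 disc].
have [q2_0|q2_neq0] := eqVneq q2 0.
  have q1_0 : q1 = 0.
    apply/eqP; rewrite -sqrf_eq0 eq_le sqr_ge0 andbT.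
    by rewrite q2_0 mulr0 in disc.
  by rewrite /qform q1_0 q2_0 !mul0r !add0r mulr_ge0 ?sqr_ge0.
have q2_gt0 : 0 < q2 by rewrite lt_def q2_neq0.
rewrite -(pmulr_rge0 _ (mulr_gt0 (ltr0n R 4) q2_gt0)).
have -> : 4 * q2 * qform q0 q1 q2 x y =
    (2 * q2 * x + q1 * y) ^+ 2 + (4 * q0 * q2 - q1 ^+ 2) * y ^+ 2.
  by rewrite /qform; ring.
by rewrite addr_ge0 ?sqr_ge0 // mulr_ge0 ?sqr_ge0 // subr_ge0.
Qed.

(** The values f(x,y,y,y) give no information on [q] at x = y because of the factor
(x-y)^2; the missing value is recovered by continuity, made explicit here. *)
Lemma psd_of_ge0_off_diag (R : realFieldType) (q0 q1 q2 : R) :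
  (forall x y, x != y -> 0 <= qform q0 q1 q2 x y) -> psd q0 q1 q2.
Proof.
move=> q_off.
have q0_ge0 : 0 <= q0.
  have := q_off 0 1; rewrite eq_sym oner_eq0 => /(_ isT).
  by rewrite /qform expr0n /= mulr0 mul0r mulr0 !add0r expr1n mulr1.
have q2_ge0 : 0 <= q2.
  have := q_off 1 0; rewrite oner_eq0 => /(_ isT).
  by rewrite /qform expr0n /= !mulr0 !addr0 expr1n mulr1.
have q_diag : 0 <= q0 + q1 + q2.
  rewrite leNgt; apply/negP => q_lt0.
  (* The linear terms cancel in q(1+s) + q(1-s) = 2 (q(1) + q2 s^2). *)
  have near (s : R) : s != 0 -> 0 <= (q0 + q1 + q2) + s ^+ 2 * q2.
    move=> s0.
    have ne1 (z : R) : z != 0 -> 1 + z != 1.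
      by apply: contra_neq => z1; lra.
    have := q_off (1 + s) 1 (ne1 s s0).
    have := q_off (1 - s) 1 (ne1 (- s) (etrans (congr1 negb (oppr_eq0 s)) s0)).
    rewrite /qform; nra.
  have [r rE] : exists r, q0 + q1 + q2 = - r.
    by exists (- (q0 + q1 + q2)); rewrite opprK.
  rewrite rE in q_lt0 near; have r_gt0 : 0 < r by rewrite -oppr_lt0.
  (* For s = r / (r + q2) in ]0, 1], one has q2 s^2 <= q2 s < r. *)
  have d_gt0 : 0 < r + q2 by rewrite ltr_wpDr.
  have := near (r / (r + q2)); rewrite mulf_neq0 ?invr_eq0 ?gt_eqF // => /(_ isT).
  rewrite -(pmulr_rge0 _ (exprn_gt0 2 d_gt0)).
  have -> : (r + q2) ^+ 2 * (- r + (r / (r + q2)) ^+ 2 * q2) =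
      - (r * (r ^+ 2 + r * q2 + q2 ^+ 2)).
    by field; rewrite gt_eqF.
  rewrite oppr_ge0 leNgt => /negP; apply.
  rewrite mulr_gt0 // -addrA ltr_pwDl ?exprn_gt0 //.
  by rewrite addr_ge0 ?sqr_ge0 // mulr_ge0 // ltW.
have q_ge0 x y : 0 <= qform q0 q1 q2 x y.
  have [->|] := eqVneq x y; last exact: q_off.
  have -> : qform q0 q1 q2 y y = (q0 + q1 + q2) * y ^+ 2 by rewrite /qform; ring.
  by rewrite mulr_ge0 ?sqr_ge0.
split=> //; have [q2_0|q2_neq0] := eqVneq q2 0.
  (* With q2 = 0, [q] is linear in x once y is fixed, so q1 must vanish. *)
  have := q_ge0 (- (q0 + 1)) q1.
  have -> : qform q0 q1 q2 (- (q0 + 1)) q1 = - q1 ^+ 2.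
    by rewrite /qform q2_0; ring.
  by rewrite q2_0 mulr0 oppr_ge0.
(* The minimum of [q] over x is at x / y = - q1 / (2 q2). *)
have := q_ge0 (- q1) (2 * q2).
have -> : qform q0 q1 q2 (- q1) (2 * q2) = q2 * (4 * q0 * q2 - q1 ^+ 2).
  by rewrite /qform; ring.
by rewrite pmulr_rge0 ?subr_ge0 // lt_def q2_neq0.
Qed.

(** A zero makes the discriminant both nonnegative and nonpositive, so it is a double
zero and [q] is [q2 (x - t y)^2]. *)
Lemma psd_root (R : realFieldType) (q0 q1 q2 t : R) :
  psd q0 q1 q2 -> qform q0 q1 q2 t 1 = 0 ->
  q1 = - 2 * t * q2 /\ q0 = t ^+ 2 * q2.
Proof.
move=> [_ _ disc]; rewrite /qform => qt.
have q0E : q0 = - (q2 * t ^+ 2 + q1 * t) by move: qt; rewrite expr1n; lra.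
have q1E : q1 = - 2 * t * q2.
  apply/eqP; rewrite -subr_eq0 -sqrf_eq0 eq_le sqr_ge0 andbT.
  have -> : (q1 - - 2 * t * q2) ^+ 2 = q1 ^+ 2 - 4 * q0 * q2 by rewrite q0E; ring.
  by rewrite subr_le0.
by split=> //; rewrite q0E q1E; ring.
Qed.

(** The same at the point (1 : 0). *)
Lemma psd_root_infty (R : realFieldType) (q0 q1 q2 : R) :
  psd q0 q1 q2 -> q2 = 0 -> q1 = 0.
Proof.
move=> [_ _ disc] q2_0; apply/eqP; rewrite -sqrf_eq0 eq_le sqr_ge0 andbT.
by rewrite q2_0 mulr0 in disc.
Qed.

(** * Coordinates on the forms vanishing at (1,1,1,1) *)

(** The coefficients are forced by linearity and by the values at g_t, with
coordinates (t^2, -2t, 1, 0), and at p, with coordinates (0, 0, 0, 1): the part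
in q0, q1, q2 is obtained from g_t by substituting q0, -q1/2, q2 for t^2, t, 1. *)
Definition cone_form {R : realType} (q0 q1 q2 mu : R) : {mpoly R[4]} :=
  quartic q2 (3^-1 * q1 - 14 / 3 * q2) (3^-1 * q0 - q1 + 3 * q2 + mu)
    (- (2 / 3) * q0 + 6 * q2 - 3 * mu)
    (- (4 / 3) * q0 + 4 * q1 - 12 * q2 + 12 * mu).

Lemma cone_formD (R : realType) (q0 q1 q2 mu q0' q1' q2' mu' : R) :
  cone_form q0 q1 q2 mu + cone_form q0' q1' q2' mu' =
  cone_form (q0 + q0') (q1 + q1') (q2 + q2') (mu + mu').
Proof. by rewrite quarticD /cone_form; congr quartic; ring. Qed.

Lemma cone_formZ (R : realType) (k q0 q1 q2 mu : R) :
  k *: cone_form q0 q1 q2 mu = cone_form (k * q0) (k * q1) (k * q2) (k * mu).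
Proof. by rewrite quarticZ /cone_form; congr quartic; ring. Qed.

Lemma g_cone_form (R : realType) (t : R) :
  g_ t = cone_form (t ^+ 2) (- 2 * t) 1 0.
Proof.
rewrite /g_ -!scaleNr -[_ + _ + _ + _ + _]/(quartic _ _ _ _ _) quarticZ.
by congr quartic; field.
Qed.

Lemma g_infty_cone_form (R : realType) : g_infty R = cone_form 3 0 0 0.
Proof.
rewrite /g_infty -!scaleNr -[sigma R 2 ^+ 2]scale1r.
have -> : 1 *: sigma R 2 ^+ 2 + - 2 *: (sigma R 1 * sigma R 3) + - 4 *: sigma R 4
    = quartic 0 0 1 (- 2) (- 4) by rewrite /quartic !scale0r !add0r.
by congr quartic; field.
Qed.

Lemma p_cone_form (R : realType) : p_ R = cone_form 0 0 0 1.
Proof.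
rewrite /p_ -!scaleNr -[sigma R 2 ^+ 2]scale1r.
have -> : 1 *: sigma R 2 ^+ 2 + - 3 *: (sigma R 1 * sigma R 3) + 12 *: sigma R 4
    = quartic 0 0 1 (- 3) 12 by rewrite /quartic !scale0r !add0r.
by congr quartic; field.
Qed.

(** A sum of squares when [q] is semidefinite.  The linear forms u, v, w span a
copy of the standard representation of S_4, and so do vw, uw, uv and the products
su, sv, sw; the squares of the combinations (t-1) s u - (t+3) v w, which vanish at
(t,1,1,1) and at (-1,-1,1,1), add up to 48 g_t.  Grouping by powers of t
gives the arguments of [qform].  The factor of [mu] is p. *)
Lemma cone_form_eval (R : realType) (q0 q1 q2 mu a b c d : R) :
  let s := a + b + c + d in let u := a + b - c - d in
  let v := a + c - b - d in let w := a + d - b - c in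
  let q x y z := qform q0 q1 q2 (s * x + 3 * (y * z)) (s * x - y * z) in
  (cone_form q0 q1 q2 mu).@[pt4 a b c d] =
    48^-1 * (q u v w + q v u w + q w u v)
    + mu / 2 * (((a - b) * (c - d)) ^+ 2 + ((a - c) * (b - d)) ^+ 2
                + ((a - d) * (b - c)) ^+ 2).
Proof.
have [e1 e2 e3 e4] := sigma_eval R a b c d.
rewrite /= /cone_form /quartic !(mevalD, mevalZ, mevalM, rmorphXn) /= e1 e2 e3 e4 /qform.
by field.
Qed.
Lemma cone_form_eval_xyyy (R : realType) (q0 q1 q2 mu x y : R) :
  (cone_form q0 q1 q2 mu).@[pt4 x y y y] = (x - y) ^+ 2 * qform q0 q1 q2 x y.
Proof. by rewrite cone_form_eval /qform; field. Qed.

Lemma cone_form_eval_yyyx (R : realType) (q0 q1 q2 mu x y : R) :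
  (cone_form q0 q1 q2 mu).@[pt4 y y y x] = (x - y) ^+ 2 * qform q0 q1 q2 x y.
Proof. by rewrite cone_form_eval /qform; field. Qed.

Lemma cone_form_eval_xxyy (R : realType) (q0 q1 q2 mu x y : R) :
  (cone_form q0 q1 q2 mu).@[pt4 x x y y] =
    (x - y) ^+ 2 * ((q0 + q1 + q2) / 3 * (x + y) ^+ 2 + mu * (x - y) ^+ 2).
Proof. by rewrite cone_form_eval /qform; field. Qed.

(** The four points used give q0, q2, q0 - q1 + q2 and mu, up to constants. *)
Lemma cone_form_inj (R : realType) (q0 q1 q2 mu q0' q1' q2' mu' : R) :
  cone_form q0 q1 q2 mu = cone_form q0' q1' q2' mu' ->
  [/\ q0 = q0', q1 = q1', q2 = q2' & mu = mu'].
Proof.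
move=> eF; have at_pt v := congr1 (meval v) eF.
have := at_pt (pt4 0 1 1 1); have := at_pt (pt4 1 0 0 0).
have := at_pt (pt4 (-1) 1 1 1); have := at_pt (pt4 (-1) (-1) 1 1).
rewrite !cone_form_eval_xyyy !cone_form_eval_xxyy /qform => e1 e2 e3 e4; split; lra.
Qed.

(** * The cone and its characterized elements *)

Lemma coneP_cone_form (R : realType) (q0 q1 q2 mu : R) :
  psd q0 q1 q2 -> 0 <= mu -> coneP (cone_form q0 q1 q2 mu).
Proof.
move=> q_psd mu_ge0; split; [exact: quartic_sym|exact: quartic_homog| |].
  by rewrite cone_form_eval_xyyy subrr expr0n mul0r.
move=> v; rewrite (meval_eq _ (pt4_eta R v)) cone_form_eval.
have q_ge0 x y := psd_ge0 R q0 q1 q2 x y q_psd.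
apply: addr_ge0; apply: mulr_ge0.
- by rewrite invr_ge0 ler0n.
- exact: addr_ge0 (addr_ge0 (q_ge0 _ _) (q_ge0 _ _)) (q_ge0 _ _).
- by rewrite divr_ge0 ?ler0n.
exact: addr_ge0 (addr_ge0 (sqr_ge0 _) (sqr_ge0 _)) (sqr_ge0 _).
Qed.

(** The cone is the product of the cone of semidefinite [q] and a half-line. *)
Lemma conePE (R : realType) (f : {mpoly R[4]}) :
  coneP f <->
  exists q0 q1 q2 mu, [/\ f = cone_form q0 q1 q2 mu, psd q0 q1 q2 & 0 <= mu].
Proof.
split=> [[fsym fhom f1 f_ge0]|[q0 [q1 [q2 [mu [-> q_psd mu_ge0]]]]]]; last first.
  exact: coneP_cone_form.
have [a [b [c [d [e fE]]]]] := sym_quarticP R f fsym fhom.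
have eE : e = - (256 * a + 96 * b + 36 * c + 16 * d).
  move: f1; have [e1 e2 e3 e4] := sigma_eval R 1 1 1 1.
  rewrite fE /quartic !(mevalD, mevalZ, mevalM, rmorphXn) /= e1 e2 e3 e4.
  by move=> ?; lra.
(* These formulas invert those in [cone_form], where the coefficients of
   sigma_2^2 and sigma_1 sigma_3 are q0/3 + mu and -2 q0/3 - 3 mu up to terms in
   q1 and q2. *)
pose c' := c + 3 * b + 11 * a; pose d' := d - 6 * a.
pose q0 := 9 * c' + 3 * d'; pose q1 := 3 * b + 14 * a; pose mu := - 2 * c' - d'.
have {eE}fE : f = cone_form q0 q1 a mu.
  by rewrite fE eE /cone_form; congr quartic; rewrite /q0 /q1 /mu /c' /d'; field.
exists q0, q1, a, mu; split=> //.
  apply: psd_of_ge0_off_diag => x y ne_xy; have := f_ge0 (pt4 x y y y).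
  rewrite fE cone_form_eval_xyyy pmulr_rge0 // exprn_even_gt0 //=.
  by rewrite subr_eq0.
by have := f_ge0 (pt4 (-1) (-1) 1 1); rewrite fE cone_form_eval_xxyy; lra.
Qed.

Lemma characterized_by_cone_form (R : realType) (f : {mpoly R[4]})
    (X : ('I_4 -> R) -> Prop) :
  coneP f -> (forall v, X v -> f.@[v] = 0) ->
  (forall q0 q1 q2 mu, psd q0 q1 q2 -> 0 <= mu ->
     (forall v, X v -> (cone_form q0 q1 q2 mu).@[v] = 0) ->
     exists c, 0 <= c /\ cone_form q0 q1 q2 mu = c *: f) ->
  characterized_by f X.
Proof.
move=> fP fX only_f; split=> // g; split.
  by case=> /conePE[q0 [q1 [q2 [mu [-> q_psd mu_ge0]]]]] gX; exact: only_f.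
move=> [c [c_ge0 ->]]; split; last by move=> v Xv; rewrite mevalZ fX ?mulr0.
have [fsym fhom f1 f_ge0] := fP.
by split=> [|||v]; rewrite ?rpredZ ?dhomogZ ?mevalZ ?f1 ?mulr0 ?mulr_ge0.
Qed.

(** If [c f = g + h] in the cone, then g and h are nonnegative and add up to 0 at the
points of [X], so that they vanish there and are multiples of [f]. *)
Lemma extremal_of_characterized (R : realType) (f : {mpoly R[4]})
    (X : ('I_4 -> R) -> Prop) (c : R) :
  f != 0 -> characterized_by f X -> 0 < c -> extremal (c *: f).
Proof.
move=> f_neq0 [fP f_char] c_gt0; have c_neq0 : c != 0 by rewrite gt_eqF.
have fX v : X v -> f.@[v] = 0.
  move=> Xv; have [_ f_in] := f_char f.
  by have [|_ ->] := f_in => //; exists 1; rewrite scale1r.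
have cfP : coneP (c *: f).
  by have [_ []] := f_char (c *: f) => //; exists c; rewrite ltW.
split=> //; first by rewrite scaler_eq0 negb_or c_neq0.
have summand g h : coneP g -> coneP h -> c *: f = g + h ->
    exists k, g = k *: (c *: f).
  move=> gP hP cfE; have [_ _ _ g_ge0] := gP; have [_ _ _ h_ge0] := hP.
  have [|k [_ ->]] := (f_char g).1; last first.
    by exists (k / c); rewrite scalerA divfK.
  split=> // v Xv; have := congr1 (meval v) cfE.
  rewrite mevalZ mevalD fX // mulr0 => /esym/eqP.
  by rewrite paddr_eq0 // => /andP[/eqP].
move=> g h gP hP cfE; split; first exact: summand cfE.
by apply: (summand h g) => //; rewrite addrC.
Qed.

Lemma scaled_g (R : realType) (t q2 : R) :
  cone_form (t ^+ 2 * q2) (- 2 * t * q2) q2 0 = q2 *: g_ t.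
Proof. by rewrite g_cone_form cone_formZ; congr cone_form; ring. Qed.

Lemma scaled_g_infty (R : realType) (q0 : R) :
  cone_form q0 0 0 0 = (q0 / 3) *: g_infty R.
Proof. by rewrite g_infty_cone_form cone_formZ; congr cone_form; field. Qed.

Lemma scaled_p (R : realType) (mu : R) : cone_form 0 0 0 mu = mu *: p_ R.
Proof. by rewrite p_cone_form cone_formZ; congr cone_form; ring. Qed.

Lemma coneP_g (R : realType) (t : R) : coneP (g_ t).
Proof. by rewrite g_cone_form; apply: coneP_cone_form => //; exact: psd_sqr. Qed.

Lemma coneP_g_infty (R : realType) : coneP (g_infty R).
Proof.
by rewrite g_infty_cone_form; apply: coneP_cone_form => //; exact/psd_const/ler0n.
Qed.

Lemma coneP_p (R : realType) : coneP (p_ R).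
Proof.
rewrite p_cone_form; apply: coneP_cone_form; rewrite ?ler01 //.
exact: psd_const.
Qed.

Lemma g_neq0 (R : realType) (t : R) : g_ t != 0.
Proof.
rewrite g_cone_form -(scale0r (cone_form 0 0 0 0)) cone_formZ.
by apply/eqP => /cone_form_inj[_ _ /eqP]; rewrite mulr0 oner_eq0.
Qed.

Lemma g_infty_neq0 (R : realType) : g_infty R != 0.
Proof.
rewrite g_infty_cone_form -(scale0r (cone_form 0 0 0 0)) cone_formZ.
by apply/eqP => /cone_form_inj[/eqP]; rewrite mulr0 pnatr_eq0.
Qed.

Lemma p_neq0 (R : realType) : p_ R != 0.
Proof.
rewrite p_cone_form -(scale0r (cone_form 0 0 0 0)) cone_formZ.
by apply/eqP => /cone_form_inj[_ _ _ /eqP]; rewrite mulr0 oner_eq0.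
Qed.

(** The zeros need only force [q] to vanish at (t : 1) and [mu] to vanish. *)
Lemma characterized_by_g (R : realType) (t : R) (X : ('I_4 -> R) -> Prop) :
  (forall v, X v -> (g_ t).@[v] = 0) ->
  (forall q0 q1 q2 mu, psd q0 q1 q2 -> 0 <= mu ->
     (forall v, X v -> (cone_form q0 q1 q2 mu).@[v] = 0) ->
     qform q0 q1 q2 t 1 = 0 /\ mu = 0) ->
  characterized_by (g_ t) X.
Proof.
move=> gX forced; apply: characterized_by_cone_form => //; first exact: coneP_g.
move=> q0 q1 q2 mu q_psd mu_ge0 /(forced _ _ _ _ q_psd mu_ge0)[qt ->].
have [q1E q0E] := psd_root R q0 q1 q2 t q_psd qt.
by exists q2; split; [case: q_psd|rewrite q1E q0E scaled_g].
Qed.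

Lemma mu_of_root (R : realType) (q0 q1 q2 mu : R) :
  (cone_form q0 q1 q2 mu).@[pt4 (-1) (-1) 1 1] = 0 -> mu = 0.
Proof. by rewrite cone_form_eval_xxyy => ?; lra. Qed.

Lemma qform_root (R : realType) (q0 q1 q2 mu t : R) :
  t != 1 -> (cone_form q0 q1 q2 mu).@[pt4 t 1 1 1] = 0 ->
  qform q0 q1 q2 t 1 = 0.
Proof.
rewrite cone_form_eval_xyyy => t1 /eqP.
by rewrite mulf_eq0 sqrf_eq0 subr_eq0 (negPf t1) => /eqP.
Qed.

Lemma characterized_g (R : realType) (t : R) : t != 1 ->
  characterized_by (g_ t) (fun v => v = pt4 t 1 1 1 \/ v = pt4 (-1) (-1) 1 1).
Proof.
move=> t1; apply: characterized_by_g => [v|q0 q1 q2 mu _ _ FX].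
  rewrite g_cone_form => -[] ->; rewrite ?cone_form_eval_xyyy ?cone_form_eval_xxyy /qform.
    by ring.
  by field.
split; first by apply: (qform_root R _ _ _ mu); rewrite ?FX //; left.
by apply: (mu_of_root R q0 q1 q2); rewrite FX //; right.
Qed.

(** On the points (x,x,y,y), the form g_1 vanishes because q(1) = 0.  The point
(t,1,1,1) says nothing at t = 1, but (0,0,1,1) detects q(1) instead. *)
Lemma characterized_g1 (R : realType) (X : ('I_4 -> R) -> Prop) :
  (forall v, X v -> exists x y, v = pt4 x x y y) ->
  X (pt4 (-1) (-1) 1 1) -> X (pt4 0 0 1 1) ->
  characterized_by (g_ (1 : R)) X.
Proof.
move=> X_xxyy X_1 X_0; apply: characterized_by_g => [v|q0 q1 q2 mu _ _ FX].
  move=> /X_xxyy[x [y ->]].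
  by rewrite g_cone_form cone_form_eval_xxyy; field.
have mu0 := mu_of_root R q0 q1 q2 mu (FX _ X_1); split=> //.
have := FX _ X_0; rewrite cone_form_eval_xxyy mu0 /qform => ?; lra.
Qed.

(** On the hyperplane s = 0, the sum of squares only involves [q] on the line through
(-3 : 1).  Of this hyperplane, (1,1,1,-3) and (-1,-1,1,1) suffice. *)
Lemma characterized_gN3 (R : realType) :
  characterized_by (g_ (-3 : R)) (fun v => exists a b c, v = pt4 a b c (- a - b - c)).
Proof.
apply: characterized_by_g => [v|q0 q1 q2 mu _ _ FX].
  move=> [a [b [c ->]]].
  by rewrite g_cone_form cone_form_eval /qform; field.
split; last first.
  apply: (mu_of_root R q0 q1 q2); apply: FX; exists (-1), (-1), 1.
  by congr pt4; ring.
have := FX (pt4 1 1 1 (-3)); rewrite cone_form_eval_yyyx /qform => FX3.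
have /FX3 : exists a b c : R, pt4 1 1 1 (-3) = pt4 a b c (- a - b - c).
  by exists 1, 1, 1; congr pt4; ring.
by move=> ?; lra.
Qed.

Lemma characterized_g_infty (R : realType) :
  characterized_by (g_infty R)
    (fun v => v = pt4 0 0 0 1 \/ v = pt4 (-1) (-1) 1 1).
Proof.
apply: characterized_by_cone_form => [|v|q0 q1 q2 mu q_psd _ FX].
- exact: coneP_g_infty.
- rewrite g_infty_cone_form => -[] ->.
    by rewrite cone_form_eval_yyyx /qform; ring.
  by rewrite cone_form_eval_xxyy; field.
have -> : mu = 0 by apply: (mu_of_root R q0 q1 q2); rewrite FX //; right.
have q2_0 : q2 = 0.
  have := FX _ (or_introl erefl).
  by rewrite cone_form_eval_yyyx /qform => ?; lra.
rewrite (psd_root_infty R q0 q1 q2) // q2_0 scaled_g_infty.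
by exists (q0 / 3); case: q_psd => q0_ge0 _ _; rewrite divr_ge0 ?ler0n.
Qed.

Lemma characterized_p (R : realType) :
  characterized_by (p_ R)
    (fun v => v = pt4 0 0 0 1 \/ exists s : R, v = pt4 s 1 1 1).
Proof.
apply: characterized_by_cone_form => [|v|q0 q1 q2 mu q_psd mu_ge0 FX].
- exact: coneP_p.
- rewrite p_cone_form => -[->|[s ->]].
    by rewrite cone_form_eval_yyyx /qform; ring.
  by rewrite cone_form_eval_xyyy /qform; ring.
have q2_0 : q2 = 0.
  have := FX _ (or_introl erefl).
  by rewrite cone_form_eval_yyyx /qform => ?; lra.
have q1_0 := psd_root_infty R q0 q1 q2 q_psd q2_0.
have q0_0 : q0 = 0.
  have := FX (pt4 0 1 1 1) (or_intror (ex_intro _ 0 erefl)).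
  by rewrite cone_form_eval_xyyy /qform => ?; lra.
by exists mu; rewrite q0_0 q1_0 q2_0 scaled_p.
Qed.

(** * Extremal elements *)

(** A nonzero [mu] splits off as a multiple of p.  When [mu = 0] and q2 > 0,
completing the square splits off the constant term [r] of [q = q2 (x - t y)^2 + r y^2]
as a multiple of g_infty. *)
Lemma extremal_normal_form (R : realType) (f : {mpoly R[4]}) :
  extremal f ->
  exists c : R, 0 < c /\
    [\/ exists t : R, f = c *: g_ t, f = c *: g_infty R | f = c *: p_ R].
Proof.
move=> [/conePE[q0 [q1 [q2 [mu [fE q_psd mu_ge0]]]]] f_neq0 indec].
have [q0_ge0 q2_ge0 disc] := q_psd.
have [mu_0|mu_neq0] := eqVneq mu 0; last first.
  have mu_gt0 : 0 < mu by rewrite lt_def mu_neq0.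
  exists mu; split=> //; apply: Or33.
  have [] := indec (cone_form q0 q1 q2 0) (cone_form 0 0 0 mu).
  - exact: coneP_cone_form.
  - by apply: coneP_cone_form => //; exact: psd_const.
  - by rewrite cone_formD fE !addr0 add0r.
  move=> [c]; rewrite fE cone_formZ => /cone_form_inj[-> -> -> /esym/eqP].
  rewrite mulf_eq0 (negPf mu_neq0) orbF => /eqP ->.
  by rewrite !mul0r scaled_p.
have [q2_0|q2_neq0] := eqVneq q2 0.
  have fE' : f = (q0 / 3) *: g_infty R.
    by rewrite fE mu_0 (psd_root_infty R q0 q1 q2) // q2_0 scaled_g_infty.
  exists (q0 / 3); split; last exact: Or32.
  rewrite lt_def divr_ge0 ?ler0n // andbT.
  by apply: contra_neq f_neq0; rewrite fE' => ->; rewrite scale0r.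
have q2_gt0 : 0 < q2 by rewrite lt_def q2_neq0.
exists q2; split=> //; apply: Or31.
pose t := - q1 / (2 * q2); pose r := q0 - t ^+ 2 * q2; exists t.
have q1E : q1 = - 2 * t * q2 by rewrite /t; field.
have r_ge0 : 0 <= r.
  have : 0 <= 4 * q2 * r.
    have -> : 4 * q2 * r = 4 * q0 * q2 - q1 ^+ 2 by rewrite /r q1E; ring.
    by rewrite subr_ge0.
  by rewrite pmulr_rge0 // mulr_gt0 ?ltr0n.
have fE' : f = q2 *: g_ t + cone_form r 0 0 0.
  by rewrite fE mu_0 -scaled_g cone_formD; congr cone_form; rewrite /r ?q1E; ring.
have [] := indec (q2 *: g_ t) (cone_form r 0 0 0).
- rewrite -scaled_g; apply: coneP_cone_form => //.
  split=> //; first by rewrite mulr_ge0 ?sqr_ge0.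
  by rewrite le_eqVlt; apply/orP; left; apply/eqP; ring.
- by apply: coneP_cone_form => //; exact: psd_const.
- exact: fE'.
move=> _ [c]; rewrite {1}fE cone_formZ => /cone_form_inj[rE _ /esym/eqP].
rewrite mulf_eq0 (negPf q2_neq0) orbF => /eqP c_0 _.
by rewrite fE' rE c_0 mul0r scaled_g_infty mul0r scale0r addr0.
Qed.

Theorem theorem1p2 (R : realType) :
  (forall f : {mpoly R[4]},
     extremal f <->
     exists c : R, 0 < c /\
       [\/ exists t : R, f = c *: g_ t,
           f = c *: g_infty R
         | f = c *: p_ R])
  /\
  (* (a) *)
  (forall t : R, t != 1 -> t != -3 ->
     characterized_by (g_ t)
       (fun v => v = pt4 t 1 1 1 \/ v = pt4 (-1) (-1) 1 1))
  /\
  (* (b), with x = oo in the projective line giving the point (1,1,0,0) *)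
  characterized_by (g_ (1 : R))
    (fun v => (exists x : R, v = pt4 x x 1 1) \/ v = pt4 1 1 0 0)
  /\
  (* (b), in homogeneous coordinates (x : y) *)
  characterized_by (g_ (1 : R))
    (fun v => exists x y : R, (x, y) <> (0, 0) /\ v = pt4 x x y y)
  /\
  (* (c) *)
  characterized_by (g_ (-3 : R))
    (fun v => exists a b c : R, v = pt4 a b c (- a - b - c))
  /\
  (* (d) *)
  characterized_by (g_infty R)
    (fun v => v = pt4 0 0 0 1 \/ v = pt4 (-1) (-1) 1 1)
  /\
  (* (e) *)
  characterized_by (p_ R)
    (fun v => v = pt4 0 0 0 1 \/ exists s : R, v = pt4 s 1 1 1).
Proof.
have g1_affine : characterized_by (g_ (1 : R))
    (fun v => (exists x : R, v = pt4 x x 1 1) \/ v = pt4 1 1 0 0).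
  apply: characterized_g1; [|by left; exists (-1)|by left; exists 0].
  by move=> v [[x ->]|->]; [exists x, 1|exists 1, 0].
split=> [f|]; first split; first exact: extremal_normal_form.
  move=> [c [c_gt0 [[t ->]|->|->]]].
  - have [->|t1] := eqVneq t 1.
      exact: extremal_of_characterized (g_neq0 R 1) g1_affine c_gt0.
    exact: extremal_of_characterized (g_neq0 R t) (characterized_g R t t1) c_gt0.
  - exact: extremal_of_characterized (g_infty_neq0 R) (characterized_g_infty R) c_gt0.
  exact: extremal_of_characterized (p_neq0 R) (characterized_p R) c_gt0.
split; first by move=> t t1 _; exact: characterized_g.
split; first exact: g1_affine.
split; last first.
  split; first exact: characterized_gN3.
  by split; [exact: characterized_g_infty|exact: characterized_p].
have neq00 (x : R) : (x, 1 : R) <> (0, 0) by case=> _ /eqP; rewrite oner_eq0.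
apply: characterized_g1; last 2 first.
- by exists (-1), 1.
- by exists 0, 1.
by move=> v [x [y [_ ->]]]; exists x, y.
Qed.
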